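(* Let $\sigma<0$, $I:=(\sigma,+\infty)$, and let $T:C(I,\mathbb{R})\to C(I,\mathbb{R})$ be an operator (not necessarily linear) with amnesia on $I$, with associated nonempty sets $H(t)\subseteq(\sigma,t)$, $t\ge 0$. Put $\sigma(t):=\inf H(t)$, $\tau(t):=\sup H(t)$ and $I(t):=[\tau(t),t]$ for $t\geq 0$. Assume that there is a positive, locally Lebesgue integrable function $b$ on $[0,+\infty)$ such that for every $t\ge 0$ and every $x\in C(I,\mathbb{R})$ $$(Tx)(t)\geq b(t)\inf_{r\in I(t)}x(r)\quad\text{whenever}\quad \inf_{r\in I(t)}x(r)>0,$$ and $$(Tx)(t)\leq b(t)\sup_{r\in I(t)}x(r)\quad\text{whenever}\quad \sup_{r\in I(t)}x(r)<0.$$ Assume also that $$\liminf_{t\to+\infty}\sigma(t)=+\infty$$ and $$\liminf_{t\to+\infty}\int_{\tau(t)}^{t}b(s)\,ds>\frac{1}{e}.$$ Then every nontrivial solution $x$ of the differential equation $$\dot{x}(t)+(Tx)(t)=0,\qquad t\geq 0,$$ either oscillates or tends monotonically to zero as $t\to+\infty$.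
   Context: $C(I,\mathbb{R})$ is the set of continuous real-valued functions on $I=(\sigma,+\infty)$. An operator $T:C(I,\mathbb{R})\to C(I,\mathbb{R})$ has an amnesia on $I$ if for each $t\geq 0$ there is a subset $H(t)\subseteq(\sigma,t)$ such that, whenever $u,v\in C(I,\mathbb{R})$ satisfy $u(r)=v(r)$ for all $r\in H(t)$, then $(Tu)(t)=(Tv)(t)$. The interval $I(t)=[\tau(t),t]$, where $\tau(t)=\sup H(t)$, is called the amnesia interval of $T$ at $t$. (The constant $\sigma$ and the function $\sigma(t)=\inf H(t)$ are different objects.) A solution is a function $x\in C(I,\mathbb{R})$ that is differentiable for $t\ge 0$ (one-sided derivative at $0$) and satisfies the equation for all $t\geq 0$; it is nontrivial if it is not identically zero. A function oscillates if it is neither eventually positive nor eventually negative (equivalently, for continuous functions, it has arbitrarily large zeros). A function tends monotonically to zero if it is eventually monotone and converges to $0$ as $t\to+\infty$. *)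

(* Defs.v *)
From HB Require Import structures.
From mathcomp Require Import all_boot all_order all_algebra.
From mathcomp Require Import all_classical all_reals all_analysis.

Set Implicit Arguments.
Unset Strict Implicit.
Unset Printing Implicit Defensive.

Import Order.TTheory GRing.Theory Num.Theory.
Import numFieldNormedType.Exports.

Local Open Scope classical_set_scope.
Local Open Scope ring_scope.

(* C(I, R) for I = ]sigma, +oo[, with the subset topology on I. *)
Definition contI (R : realType) (sigma : R) : Type :=
  continuousType (set_type `]sigma, +oo[%classic) R.

(* x(t) for a real number t; the value is 0 when t is not in I, and no notion
   below depends on values outside I. *)
Definition ev (R : realType) (sigma : R) (x : contI sigma) : R -> R :=
  valL (x : set_type `]sigma, +oo[%classic -> R).

Definition amnesia_sets (R : realType) (sigma : R)
    (T : contI sigma -> contI sigma) (H : R -> set R) : Prop :=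
  forall t : R, 0 <= t ->
    H t `<=` `]sigma, t[%classic /\
    forall u v : contI sigma,
      (forall r, H t r -> ev u r = ev v r) -> ev (T u) t = ev (T v) t.

Definition amnesia_interval (R : realType) (H : R -> set R) (t : R) : set R :=
  `[sup (H t), t]%classic.

(* The library's [locally_integrable D f] requires D to be open, which
   [0, +oo[ is not. *)
Definition locally_integrable_ge0 (R : realType) (b : R -> R) : Prop :=
  forall K : set R, K `<=` `[0, +oo[%classic -> compact K ->
    (@lebesgue_measure R).-integrable K (EFin \o b).

Definition right_quotient (R : realType) (f : R -> R) (a h : R) : R :=
  (f (a + h) - f a) / h.

(* x'(t) + (T x)(t) = 0 for t >= 0, the derivative at 0 being one-sided. *)
Definition is_solution (R : realType) (sigma : R)
    (T : contI sigma -> contI sigma) (x : contI sigma) : Prop :=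
  [/\ forall t : R, 0 < t ->
        derivable (ev x) t 1 /\ 'D_1 (ev x) t + ev (T x) t = 0,
      cvg (right_quotient (ev x) 0 h @[h --> 0^'+]) &
      lim (right_quotient (ev x) 0 h @[h --> 0^'+]) + ev (T x) 0 = 0].

Definition nontrivial (R : realType) (sigma : R) (x : contI sigma) : Prop :=
  ~ (forall r, x r = 0).

Definition oscillates (R : realType) (f : R -> R) : Prop :=
  ~ (\forall t \near +oo, 0 < f t) /\ ~ (\forall t \near +oo, f t < 0).

Definition eventually_monotone (R : realType) (f : R -> R) : Prop :=
  exists t0 : R,
    {in `[t0, +oo[ &, {homo f : s t / s <= t}} \/
    {in `[t0, +oo[ &, {homo f : s t /~ s <= t}}.

Definition tends_monotonically_to_zero (R : realType) (f : R -> R) : Prop :=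
  eventually_monotone f /\ f t @[t --> +oo] --> 0.

(* Main.v *)
(* On an eventually positive solution the amnesia intervals eventually lie where
   x > 0, so T x > 0 and x decreases. If x stayed above eps > 0, then
   x(tau(t)) - x(t) = \int_[tau(t), t] T x >= eps \int_[tau(t), t] b > eps / e
   for all large t, contradicting the convergence of x. The eventually negative
   case is the same argument applied to - x. *)
Require Import Defs.
From HB Require Import structures.
From mathcomp Require Import all_boot all_order all_algebra.
From mathcomp Require Import all_classical all_reals all_analysis.
From mathcomp Require Import measurable_realfun lra.

Import Order.TTheory GRing.Theory Num.Theory.
Import numFieldNormedType.Exports.

Local Open Scope classical_set_scope.
Local Open Scope ring_scope.

(** The lower limit is a supremum of infima over sets of [F], so one such infimum already exceeds
    [c]. This turns both liminf hypotheses of the theorem into bounds valid for all large [t]. *)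
Lemma lt_limf_einf {R : realType} {T : choiceType} {X : filteredType T}
    (f : X -> \bar R) (F : set_system X) (c : \bar R) : Filter F ->
  (c < limf_einf f F)%E -> \forall t \near F, (c < f t)%E.
Proof.
move=> FF; rewrite limf_einfE => /ereal_sup_gt[_ [V FV <-]] cV.
apply: filterS FV => t Vt; apply: lt_le_trans cV _.
by apply: ereal_inf_lbound; exists t.
Qed.

(** Monotonicity lets a single value below [e] control all later ones. *)
Lemma nonincreasing_ge0_cvg0 {R : realType} (f : R -> R) (a : R) :
  (forall s t, a <= s -> s <= t -> f t <= f s) ->
  (forall t, a <= t -> 0 <= f t) ->
  (forall e, 0 < e -> exists2 t, a <= t & f t < e) ->
  tends_monotonically_to_zero f.
Proof.
move=> f_noninc f_ge0 f_small; split.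
  exists a; right => s t; rewrite !in_itv/= !andbT => _ ta; exact: f_noninc.
apply/cvgrPdist_lt => e /f_small[s as_ fse]; near=> t.
have st : s <= t by near: t; apply: nbhs_pinfty_ge; rewrite num_real.
rewrite sub0r normrN ger0_norm; last by apply: f_ge0; exact: le_trans st.
by apply: le_lt_trans fse; exact: f_noninc.
Unshelve. all: by end_near. Qed.

Lemma tends_monotonically_to_zeroN {R : realType} (f : R -> R) :
  tends_monotonically_to_zero (- f) -> tends_monotonically_to_zero f.
Proof.
move=> [[a mono] Nf0]; split; last first.
  by rewrite -[f]opprK -[X in _ --> X]oppr0; exact: cvgN.
exists a; case: mono => mono; [right|left] => s t sa ta st;
  by have := mono _ _ ta sa st; rewrite lerN2.
Qed.

(** Scalar form of the problem, free of the operator: [(f, g)] is [(x, T x)] or [(-x, -(T x))], and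
    [c] is [1/e]. Stating [g_ge] with an arbitrary lower bound [m] serves both the infimum of [x]
    and the supremum in the negative case. *)
Section delay_inequality.
Context {R : realType}.
Local Notation mu := (@lebesgue_measure R).
Variables (f g b tau : R -> R) (a c : R).
Hypothesis c_gt0 : 0 < c.
Hypothesis f_gt0 : forall t, a < t -> 0 < f t.
Hypothesis df : forall t, a < t -> is_derive t 1 f (- g t).
Hypothesis cg : forall t, a < t -> {for t, continuous g}.
Hypothesis b_gt0 : forall t, a < t -> 0 < b t.
Hypothesis mb : forall s t, a < s -> measurable_fun `[s, t] b.
Hypothesis tau_le : forall t, a < t -> tau t <= t.
Hypothesis tau_y : tau t @[t --> +oo] --> +oo.
Hypothesis g_ge : forall t m, a < t -> 0 < m ->
  (forall r, r \in `[tau t, t] -> m <= f r) -> b t * m <= g t.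
Hypothesis int_b : forall t, a < t ->
  (c%:E < \int[mu]_(s in `[tau t, t]) (b s)%:E)%E.

Let cf t : a < t -> {for t, continuous f}.
Proof.
by move=> /df f_t; apply/differentiable_continuous/derivable1_diffP.
Qed.

Let cf_itv s t : a < s -> {within `[s, t], continuous f}.
Proof.
move=> s_gta; apply: continuous_in_subspaceT => r /set_mem/=.
by rewrite in_itv/= => /andP[sr _]; apply: cf; exact: lt_le_trans sr.
Qed.

(** The minimum of [f] over the compact interval [[tau t, t]] is attained, hence positive, and can
    serve as [m] in [g_ge]. *)
Lemma delay_g_gt0 t : a < t -> a < tau t -> 0 < g t.
Proof.
move=> at_ atau; have [r rI fr] := EVT_min (tau_le t at_) (cf_itv _ _ atau).
have fr0 : 0 < f r.
  by apply: f_gt0; move: rI; rewrite in_itv/= => /andP[+ _]; exact: lt_le_trans.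
by apply: lt_le_trans (g_ge _ _ at_ fr0 fr); rewrite mulr_gt0// b_gt0.
Qed.

Lemma delay_drop (s t : R) : a < s -> s < t ->
  ((f s - f t)%:E = \int[mu]_(r in `[s, t]) (g r)%:E)%E.
Proof.
move=> as_ st.
rewrite (@continuous_FTC2 R g (- f) s t)//.
- by rewrite -EFinB/= opprK addrC.
- apply: continuous_in_subspaceT => r /set_mem/=.
  by rewrite in_itv/= => /andP[sr _]; apply: cg; exact: lt_le_trans sr.
- split.
  + move=> r; rewrite in_itv/= => /andP[sr _].
    by have := df _ (lt_trans as_ sr) => -[? _]; exact: derivableN.
  + by apply: cvg_at_right_filter; apply: continuousN; exact: cf.
  + apply: cvg_at_left_filter; apply: continuousN; apply: cf.
    exact: lt_trans st.
- move=> r; rewrite in_itv/= => /andP[sr _].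
  have [dr Dr] := df _ (lt_trans as_ sr).
  by rewrite derive1E deriveN// Dr opprK.
Qed.

Lemma delay_inequality_cvg0 : tends_monotonically_to_zero f.
Proof.
have [a1 [_ tau_gt]] : \forall t \near +oo, a < tau t.
  by move/cvgryPgt : tau_y; exact.
(* The [+ 1] puts the closed half-line from [A] strictly beyond both thresholds. *)
pose A := Num.max a a1 + 1.
have A_gt t : A <= t -> a < t /\ a1 < t.
  rewrite /A => At.
  have : a <= Num.max a a1 by rewrite le_max lexx.
  have : a1 <= Num.max a a1 by rewrite le_max lexx orbT.
  by split; lra.
have f_noninc s t : A <= s -> s <= t -> f t <= f s.
  move=> As; apply: (@ler0_derive1_nincry _ f A) => //.
  - by move=> r; rewrite in_itv/= andbT => /ltW/A_gt[/df[]].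
  - move=> r; rewrite in_itv/= andbT => /ltW/A_gt[ar /tau_gt atau].
    have [_ D_f] := df _ ar.
    by rewrite derive1E D_f oppr_le0 ltW// delay_g_gt0.
  - apply: continuous_in_subspaceT => r /set_mem/=.
    by rewrite in_itv/= andbT => /A_gt[ar _]; exact: cf.
apply: (@nonincreasing_ge0_cvg0 _ f A) => //.
  by move=> t /A_gt[at_ _]; rewrite ltW// f_gt0.
move=> e e_gt0; apply: contrapT => f_ge.
have {}f_ge t : A <= t -> e <= f t.
  by move=> At; rewrite leNgt; apply/negP => fte; apply: f_ge; exists t.
pose E := f @` `[A, +oo[.
have E_lb : has_lbound E.
  by exists e => _ [r /= + <-]; rewrite in_itv/= andbT; exact: f_ge.
have E_inf : has_inf E.
  by split=> //; exists (f A), A => //=; rewrite in_itv/= lexx.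
(* From [s] on, [f] can lose less than [e * c], since [f s] is within [e * c] of its infimum. *)
have [_ [s + <-] fs] := inf_adherent (mulr_gt0 e_gt0 c_gt0) E_inf.
rewrite /= in_itv/= andbT => As.
have [B [_ tauA]] : \forall r \near +oo, A <= tau r.
  by move/cvgryPge : tau_y; exact.
(* Two delays are needed: for [r] in [[tau t, t]], [B < tau t] gives [A <= tau r], so [f] is at
   least [e] on all of [[tau r, r]]. *)
have [t [stau Btau ts]] : exists t, [/\ s <= tau t, B < tau t & A <= t].
  apply: (@filter_ex _ (pinfty_nbhs R)); near=> t; split; near: t.
  - by move/cvgryPge : tau_y; exact.
  - by move/cvgryPgt : tau_y; exact.
  - by apply: nbhs_pinfty_ge; rewrite num_real.
have [at_ a1t] := A_gt _ ts.
have Atau : A <= tau t := le_trans As stau.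
have [atau _] := A_gt _ Atau.
have ct := int_b t at_.
(* A degenerate interval would give a zero integral, which cannot exceed [c]. *)
have tau_lt : tau t < t.
  rewrite lt_neqAle tau_le// andbT; apply/eqP => taut.
  by move: ct; rewrite taut set_itv1 integral_set1 lte_fin ltNge ltW.
(* Integrates [e * b r <= g r], obtained from [g_ge] with [m := e]. *)
have : (e%:E * \int[mu]_(r in `[tau t, t]) (b r)%:E <= (f (tau t) - f t)%:E)%E.
  rewrite delay_drop// -ge0_integralZl//=; last 3 first.
  - by apply/measurable_EFinP; exact: mb.
  - move=> r; rewrite in_itv/= => /andP[+ _] => taur.
    by rewrite lee_fin ltW// b_gt0//; exact: lt_le_trans taur.
  - by rewrite lee_fin ltW.
  apply: ge0_le_integral => //=.
  - move=> r; rewrite in_itv/= => /andP[taur _].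
    by rewrite -EFinM lee_fin mulr_ge0// ltW// b_gt0//; exact: lt_le_trans taur.
  - by apply: measurable_funeM; apply/measurable_EFinP; exact: mb.
  - apply/measurable_EFinP; apply: subspace_continuous_measurable_fun => //.
    apply: continuous_in_subspaceT => r /set_mem/=.
    by rewrite in_itv/= => /andP[sr _]; apply: cg; exact: lt_le_trans sr.
  - move=> r; rewrite in_itv/= => /andP[taur _].
    have Ar := le_trans Atau taur; have [ar a1r] := A_gt _ Ar.
    rewrite -EFinM lee_fin mulrC; apply: g_ge => // q.
    rewrite in_itv/= => /andP[tauq _]; apply: f_ge; apply: le_trans tauq.
    by apply: tauA; exact: lt_le_trans taur.
apply/negP; rewrite -ltNge.
apply: (@lt_trans _ _ (e * c)%:E); last first.
  by rewrite EFinM lte_pmul2l// lte_fin.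
(* [f (tau t) <= f s < inf E + e * c <= f t + e * c]. *)
rewrite lte_fin ltrBlDr; apply: (le_lt_trans (f_noninc _ _ As stau)).
apply: lt_le_trans fs _; rewrite addrC lerD2l; apply: ge_inf => //.
by exists t => //=; rewrite in_itv/= andbT.
Unshelve. all: by end_near. Qed.

End delay_inequality.

Theorem theorem2p1 (R : realType) (sigma : R) (sigma_lt0 : sigma < 0)
    (T : contI sigma -> contI sigma) (H : R -> set R)
    (TH : amnesia_sets T H)
    (H_neq0 : forall t : R, 0 <= t -> H t !=set0)
    (b : R -> R)
    (b_gt0 : forall t : R, 0 <= t -> 0 < b t)
    (b_int : locally_integrable_ge0 b)
    (T_ge : forall (t : R) (x : contI sigma), 0 <= t ->
      0 < inf [set ev x r | r in amnesia_interval H t] ->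
      b t * inf [set ev x r | r in amnesia_interval H t] <= ev (T x) t)
    (T_le : forall (t : R) (x : contI sigma), 0 <= t ->
      sup [set ev x r | r in amnesia_interval H t] < 0 ->
      ev (T x) t <= b t * sup [set ev x r | r in amnesia_interval H t])
    (liminf_sigma :
      limf_einf (fun t : R => (inf (H t))%:E) (pinfty_nbhs R) = +oo%E)
    (liminf_int :
      ((expR 1)^-1%:E < limf_einf
        (fun t : R => \int[@lebesgue_measure R]_(s in amnesia_interval H t)
                        (b s)%:E) (pinfty_nbhs R))%E)
    (x : contI sigma) (x_sol : is_solution T x) (x_neq0 : nontrivial x) :
  oscillates (ev x) \/ tends_monotonically_to_zero (ev x).
Proof.
have tau_le (t : R) : 0 <= t -> sup (H t) <= t.
  move=> t0; apply: ge_sup; first exact: H_neq0.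
  by have [Ht _] := TH _ t0 => r /Ht; rewrite /= in_itv/= => /andP[_ /ltW].
(* Any point of [H t] lies between [inf (H t)] and [sup (H t)], so [sup (H t)] inherits the
   divergence of [inf (H t)]. *)
have tau_y : sup (H t) @[t --> +oo] --> +oo.
  apply/cvgryPge => M; near=> t.
  have t0 : 0 <= t by near: t; exact: nbhs_pinfty_ge.
  have [Ht _] := TH _ t0; have [r Hr] := H_neq0 _ t0.
  have MH : M < inf (H t).
    rewrite -lte_fin; near: t; apply: lt_limf_einf.
    by rewrite liminf_sigma ltry.
  apply: (le_trans (ltW MH)); apply: (@le_trans _ _ r).
    apply: ge_inf => //; exists sigma => q /Ht.
    by rewrite /= in_itv/= => /andP[/ltW].
  apply: ub_le_sup => //; exists t => q /Ht.
  by rewrite /= in_itv/= => /andP[_ /ltW].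
(* As [I] is open, continuity on the subtype becomes ordinary continuity of [ev (T x)] at points of
   [I]. *)
have cTx (t : R) : 0 < t -> {for t, continuous (ev (T x))}.
  move=> t0.
  have /subspace_valL_continuousP : continuous (T x : set_type _ -> R).
    exact: cts_fun.
  rewrite continuous_open_subspace//; apply.
  by rewrite inE /= in_itv/= andbT; exact: lt_trans t0.
have Dx (t : R) : 0 < t -> is_derive t 1 (ev x) (- ev (T x) t).
  case: x_sol => + _ _ => /[apply] -[dx Dx]; apply: DeriveDef => //.
  by apply/eqP; rewrite -addr_eq0 Dx.
have e_gt0 : 0 < (expR 1 : R)^-1 by rewrite invr_gt0 expR_gt0.
have mb (s t : R) : 0 < s -> measurable_fun `[s, t] b.
  move=> s0; apply/measurable_EFinP.
  apply: (@measurable_int _ _ _ lebesgue_measure); apply: b_int.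
    apply: subset_itv; rewrite bnd_simp//; exact: ltW.
  exact: segment_compact.
have [a0 [_ int_b]] := lt_limf_einf _ _ _ _ liminf_int.
have gt_bounds (a t : R) :
  Num.max 0 (Num.max a0 a) < t -> [/\ 0 < t, a0 < t & a < t].
  by rewrite !gt_max => /and3P[].
have img_neq0 (t : R) :
  0 <= t -> [set ev x r | r in amnesia_interval H t] !=set0.
  move=> t0; exists (ev x t), t => //=.
  by rewrite /amnesia_interval/= in_itv/= lexx tau_le.
apply: contrapT => /not_orP[/not_andP + not0].
case=> /contrapT[a1 [_ x_a1]]; apply: not0.
- apply: (@delay_inequality_cvg0 R (ev x) (ev (T x)) b (fun t => sup (H t))
    (Num.max 0 (Num.max a0 a1)) _ e_gt0) => //.
  + by move=> t /gt_bounds[_ _ /x_a1].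
  + by move=> t /gt_bounds[/Dx].
  + by move=> t /gt_bounds[/cTx].
  + by move=> t /gt_bounds[/ltW/b_gt0].
  + by move=> s t /gt_bounds[/mb].
  + by move=> t /gt_bounds[/ltW/tau_le].
  + move=> t m /gt_bounds[/ltW t0 _ _] m0 m_le.
    (* Nonemptiness of the image matters here: the infimum of an empty set is 0 by default. *)
    have m_inf : m <= inf [set ev x r | r in amnesia_interval H t].
      apply: lb_le_inf => [|_ [r rI <-]]; last exact: m_le.
      exact: img_neq0.
    apply: le_trans (T_ge _ _ t0 (lt_le_trans m0 m_inf)).
    by rewrite ler_pM2l// b_gt0.
  + by move=> t /gt_bounds[_ /int_b].
- apply: tends_monotonically_to_zeroN.
  (* [T] need not be linear, so [g] is [- ev (T x)] rather than [T] applied to [-x]; [T_le] supplies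
     the bound. *)
  apply: (@delay_inequality_cvg0 R (- ev x) (- ev (T x)) b (fun t => sup (H t))
    (Num.max 0 (Num.max a0 a1)) _ e_gt0) => //.
  + by move=> t /gt_bounds[_ _ /x_a1]; rewrite oppr_gt0.
  + by move=> t /gt_bounds[/Dx dx _ _]; exact: is_deriveN.
  + by move=> t /gt_bounds[/cTx ? _ _]; exact: continuousN.
  + by move=> t /gt_bounds[/ltW ? _ _]; exact: b_gt0.
  + by move=> s t /gt_bounds[/mb].
  + by move=> t /gt_bounds[/ltW/tau_le].
  + move=> t m /gt_bounds[/ltW t0 _ _] m0 m_le.
    have sup_m : sup [set ev x r | r in amnesia_interval H t] <= - m.
      apply: ge_sup => [|_ [r rI <-]]; last by rewrite lerNr; exact: m_le.
      exact: img_neq0.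
    have sup_lt0 : sup [set ev x r | r in amnesia_interval H t] < 0.
      by apply: le_lt_trans sup_m _; rewrite oppr_lt0.
    rewrite lerNr; apply: le_trans (T_le _ _ t0 sup_lt0) _.
    by rewrite -mulrN ler_pM2l// b_gt0.
  + by move=> t /gt_bounds[_ /int_b].
Unshelve. all: by end_near. Qed.
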